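(* Let $H$ be an instance hypergraph of MTRS-minNum (as described in the context) such that $|\Delta|=|R|$ and for every $\eta\in\Delta$ and every $r\in R$, $\{\eta,r\}$ is an edge of $H$, and let $\lambda=\max_{\eta\in\Delta}\lambda_\eta\ge 2$. Let $M$ be the solution output by Algorithm GreedyMinNum and $M^*$ an optimal solution of MTRS-minNum. Then $\frac{|M|}{|M^*|}\le\frac{\lambda+2}{2}$.
   Context: An instance of MTRS-minNum: finite sets $R$ (riders) and $D=\Delta$ (designated drivers), each driver $\eta$ with capacity $\lambda_\eta\ge 1$; a hypergraph $H$ with vertex set $\Delta\cup R$ whose edges (feasible matches) are sets $\{\eta\}\cup S$ with $\eta\in\Delta$, $\emptyset\neq S\subseteq R$, $|S|\le\lambda_\eta$; for $e=\{\eta\}\cup S$ write $D(e)=\eta$, $R(e)=S$. The edge set is closed under nonempty subsets of riders: if $\{\eta\}\cup S$ is an edge with $|S|\ge2$ then $\{\eta\}\cup S'$ is an edge for every nonempty $S'\subseteq S$. A feasible solution is a set of pairwise vertex-disjoint edges covering every rider; an optimal solution is a feasible solution of minimum cardinality. Algorithm GreedyMinNum: start with $M=\emptyset$ and the original $H$; repeatedly select an edge $e$ of the current hypergraph with maximum $|R(e)|$, add it to $M$, and delete all vertices of $e$ and all edges containing a vertex of $e$; stop when every rider is covered by $M$. *)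

(* Defs.v *)
From mathcomp Require Import all_boot all_order all_algebra.

Set Implicit Arguments.
Unset Strict Implicit.
Unset Printing Implicit Defensive.

Record hypergraph (T : finType) := Hypergraph {
  hverts : {set T};
  hedges : {set {set T}}
}.

Definition hdelete (T : finType) (H : hypergraph T) (e : {set T}) :
    hypergraph T :=
  Hypergraph (hverts H :\: e) [set f in hedges H | [disjoint f & e]].

Section Matches.

(* Vertices are elements of the disjoint union D + R: drivers are inl eta,
   riders are inr r. *)
Variables D R : finType.

Definition match_edge (eta : D) (S : {set R}) : {set D + R} :=
  inl eta |: [set inr r | r in S].

Definition edge_riders (e : {set D + R}) : {set R} := [set r | inr r \in e].

Record mtrs_instance := MtrsInstance {
  capacity : D -> nat;
  instance_hypergraph : hypergraph (D + R)%type;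
  capacity_ge1 : forall eta, 1 <= capacity eta;
  instance_verts : hverts instance_hypergraph = [set: D + R];
  instance_edges : forall e, e \in hedges instance_hypergraph ->
    exists eta S,
      [/\ e = match_edge eta S, S != set0 & #|S| <= capacity eta];
  instance_closed : forall eta (S S' : {set R}),
    match_edge eta S \in hedges instance_hypergraph -> 2 <= #|S| ->
    S' != set0 -> S' \subset S ->
    match_edge eta S' \in hedges instance_hypergraph
}.

Definition covers_riders (M : {set {set D + R}}) : Prop :=
  forall r : R, inr r \in cover M.

Definition feasible_solution (I : mtrs_instance) (M : {set {set D + R}}) :
    Prop :=
  [/\ M \subset hedges (instance_hypergraph I), trivIset M & covers_riders M].

Definition optimal_solution (I : mtrs_instance) (M : {set {set D + R}}) :
    Prop :=
  feasible_solution I M /\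
  forall M', feasible_solution I M' -> #|M| <= #|M'|.

(* greedy_run I M H: some sequence of selections (ties broken arbitrarily)
   leads to the partial solution M and the current hypergraph H. *)
Inductive greedy_run (I : mtrs_instance) :
    {set {set D + R}} -> hypergraph (D + R)%type -> Prop :=
| GreedyStart : greedy_run I set0 (instance_hypergraph I)
| GreedySelect M H e :
    greedy_run I M H -> ~ covers_riders M ->
    e \in hedges H ->
    (forall f, f \in hedges H -> #|edge_riders f| <= #|edge_riders e|) ->
    greedy_run I (e |: M) (hdelete H e).

Definition greedy_output (I : mtrs_instance) (M : {set {set D + R}}) : Prop :=
  (exists H, greedy_run I M H) /\ covers_riders M.

Definition max_capacity (I : mtrs_instance) : nat :=
  \max_(eta : D) capacity I eta.

End Matches.

(* Main.v *)
(** For an optimal edge [f], let [y f] be the number of its riders that greedy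
    covers by singleton edges.  If [y f >= 2], then the driver of [f] must be
    used by a greedy edge with at least [y f] riders: as long as this driver is
    free, closure under rider subsets keeps the part of [f] still uncovered
    available, so greedy does not get down to singletons, and the edge that
    finally takes the driver is at least as large as what is left of [f].
    These greedy edges are distinct for distinct [f], hence
    [\sum_f (y f - 2) <= \sum_(e in M) (#|R(e)| - 2)].  Since moreover
    [2 + (#|R(e)| - 2)] is [#|R(e)|], plus one when [e] is a singleton, summing
    over [M] gives [2 #|M| <= #|R| + 2 #|Mopt| <= (lambda + 2) #|Mopt|]. *)

Require Import Defs.
From mathcomp Require Import all_boot all_order all_algebra.
From mathcomp Require Import zify.

Set Implicit Arguments.
Unset Strict Implicit.
Unset Printing Implicit Defensive.

Import Order.TTheory GRing.Theory Num.Theory.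
Local Open Scope ring_scope.

Section Riders.
Variables D R : finType.
Implicit Types (e f : {set D + R}) (P Q : {set {set D + R}}) (S A : {set R}).
Local Open Scope nat_scope.

Lemma inl_match_edge (d eta : D) S : (inl d \in match_edge eta S) = (d == eta).
Proof.
rewrite !inE; case: eqP => [[->]|nd]; first by rewrite eqxx.
by case: eqP nd => [-> []//|_ _]; apply/imsetP => -[].
Qed.

Lemma inr_match_edge (r : R) (eta : D) S :
  (inr r \in match_edge eta S) = (r \in S).
Proof. by rewrite !inE /= mem_imset // => x y []. Qed.

Lemma edge_riders_match (eta : D) S : edge_riders (match_edge eta S) = S.
Proof. by apply/setP => r; rewrite inE inr_match_edge. Qed.

Lemma edge_ridersS e f :
  e \subset f -> edge_riders e \subset edge_riders f.
Proof. by move=> /subsetP sef; apply/subsetP => r; rewrite !inE => /sef. Qed.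

Lemma disjoint_match_edge (eta : D) S e :
  [disjoint match_edge eta S & e]
  = (inl eta \notin e) && [disjoint S & edge_riders e].
Proof.
apply/idP/andP => [dis|[etae dis]].
  split; first by rewrite (disjointFr dis) // inl_match_edge.
  apply/pred0P => r /=; apply/negP => /andP[rS].
  by rewrite inE (disjointFr dis) // inr_match_edge.
apply/pred0P => -[d|r] /=; apply/negP => /andP[].
  by rewrite inl_match_edge => /eqP->; apply/negP.
rewrite inr_match_edge => rS re.
by have := disjointFr dis rS; rewrite inE re.
Qed.

(** Double counting: since the edges of [P] are disjoint, each covered rider of [A] lies in exactly
    one of them. *)
Lemma sum_card_edge_riders P A : trivIset P ->
  \sum_(e in P) #|edge_riders e :&: A| = #|edge_riders (cover P) :&: A|.
Proof.
move=> triv; rewrite -sum1_card.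
under eq_bigr => e _ do rewrite -sum1_card big_mkcond /=.
rewrite exchange_big [RHS]big_mkcond; apply: eq_bigr => r _.
case: ifP => [|/negbT rN]; last first.
  rewrite big1 // => e eP; case: ifP => // re; case/negP: rN.
  move: re; rewrite !inE => /andP[re ->]; rewrite andbT.
  by apply/bigcupP; exists e.
rewrite !inE => /andP[/bigcupP[e eP re] rA].
rewrite (bigD1 e) //= !inE re rA big1 // => f /andP[fP nfe].
have dis := trivIsetP triv _ _ fP eP nfe.
by rewrite !inE (disjointFl dis re).
Qed.

Lemma sum_card_covering P : trivIset P -> covers_riders P ->
  \sum_(e in P) #|edge_riders e| = #|R|.
Proof.
move=> triv cov; rewrite (_ : #|R| = #|edge_riders (cover P) :&: setT|).
  by rewrite -sum_card_edge_riders //; under [RHS]eq_bigr do rewrite setIT.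
by rewrite -cardsT; congr #|pred_of_set _|; apply/setP => r; rewrite !inE cov.
Qed.

Lemma cover_setU1 e P : cover (e |: P) = e :|: cover P.
Proof. by rewrite /cover bigcup_setU big_set1. Qed.

Definition shared_matches P : {set {set D + R}} :=
  [set e in P | 1 < #|edge_riders e|].

(** Taken as a complement so that it makes sense for a partial solution: riders not yet covered
    count as unshared, and the set only shrinks as greedy proceeds. Once [P] covers all riders, it
    consists of the riders of singleton edges. *)
Definition unshared_riders P : {set R} :=
  ~: edge_riders (cover (shared_matches P)).

Lemma unshared_ridersS P Q :
  P \subset Q -> unshared_riders Q \subset unshared_riders P.
Proof.
move=> sPQ; rewrite setCS; apply: edge_ridersS; apply/bigcupsP => e.
rewrite !inE => /andP[eP re]; apply: bigcup_sup.
by rewrite inE re (subsetP sPQ).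
Qed.

Lemma card_unshared_riders P : trivIset P -> covers_riders P ->
  #|unshared_riders P| = \sum_(e in P | #|edge_riders e| <= 1) #|edge_riders e|.
Proof.
move=> triv cov.
have tr2 : trivIset (shared_matches P).
  by apply: trivIsetS triv; apply/subsetP => e; rewrite inE => /andP[].
have h := sum_card_edge_riders setT tr2.
rewrite setIT in h.
apply: (@addnI #|edge_riders (cover (shared_matches P))|).
rewrite cardsC -(sum_card_covering triv cov) -h.
rewrite (bigID (fun e => 1 < #|edge_riders e|)) /=.
congr (_ + _); last by apply: eq_bigl => e; rewrite -leqNgt.
by apply: eq_big => e; rewrite ?inE // setIT.
Qed.

End Riders.

Section Greedy.
Variables (D R : finType) (I : mtrs_instance D R).
Implicit Types (e f : {set D + R}) (M N : {set {set D + R}}) (S : {set R}).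
Local Open Scope nat_scope.
Local Notation E := (hedges (instance_hypergraph I)).

Lemma edge_gt0 e : e \in E -> 0 < #|edge_riders e|.
Proof.
by move=> /instance_edges[eta [S [-> S0 _]]]; rewrite edge_riders_match card_gt0.
Qed.

Lemma edge_le_max e : e \in E -> #|edge_riders e| <= max_capacity I.
Proof.
move=> /instance_edges[eta [S [-> _ cS]]]; rewrite edge_riders_match.
exact: leq_trans cS (leq_bigmax eta).
Qed.

Lemma greedy_edgesE M H : greedy_run I M H ->
  hedges H = [set f in E | [disjoint f & cover M]].
Proof.
elim=> [|M' H' e _ IH _ _ _].
  apply/setP => f; rewrite inE /cover big_set0.
  by rewrite -setI_eq0 setI0 eqxx andbT.
apply/setP => f; rewrite /= IH !inE cover_setU1 -!setI_eq0 setIUr setU_eq0.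
by rewrite -andbA; congr (_ && _); rewrite andbC.
Qed.

Lemma greedy_run_triv M H : greedy_run I M H -> M \subset E /\ trivIset M.
Proof.
elim=> [|M' H' e run [sub triv] _ eH _].
  by split; [exact: sub0set | apply/trivIsetP => A B; rewrite inE].
move: eH; rewrite (greedy_edgesE run) inE => /andP[eE dis]; split.
  by rewrite subUset sub1set eE.
have disM f : f \in M' -> [disjoint e & f].
  by move=> fM; apply: disjointWr dis; apply: bigcup_sup.
apply/trivIsetP => A B; rewrite !inE.
case/predU1P => [->|AM]; case/predU1P => [->|BM]; rewrite ?eqxx // => neq.
- exact: disM.
- by rewrite disjoint_sym; apply: disM.
- exact: (trivIsetP triv).
Qed.

(** Invariant of the run, by induction on the selections: as long as no large enough edge has taken
    the driver [eta], both [eta] and all of [Y] are untouched. *)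
Lemma greedy_run_large M H (eta : D) S : greedy_run I M H ->
  match_edge eta S \in E ->
  let Y := S :&: unshared_riders M in 1 < #|Y| ->
  (exists e, [/\ e \in M, inl eta \in e & #|Y| <= #|edge_riders e|])
  \/ [disjoint match_edge eta Y & cover M].
Proof.
move=> run SE; elim: run => [|M' H' e run IH _ _ emax] Y Y2.
  by right; rewrite /cover big_set0 -setI_eq0 setI0.
set Y' := S :&: unshared_riders M' in IH.
have sY : Y \subset Y' by rewrite setIS // unshared_ridersS // subsetUr.
have lY : #|Y| <= #|Y'| := subset_leq_card sY.
have Y'2 : 1 < #|Y'| := leq_trans Y2 lY.
(* An edge found earlier still serves, because [Y] is contained in [Y']. *)
case: (IH Y'2) => [[f [fM etaf lf]]|dis].
  by left; exists f; split; rewrite ?inE ?fM ?orbT //; apply: leq_trans lY lf.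
have Y'E : match_edge eta Y' \in E.
  apply: (instance_closed SE); rewrite ?subsetIl //.
    by apply: leq_trans Y'2 _; rewrite subset_leq_card // subsetIl.
  by rewrite -card_gt0 ltnW.
(* By [dis], the edge on [eta] and [Y'] was still available when greedy preferred [e]. *)
have le : #|Y'| <= #|edge_riders e|.
  rewrite -{1}(edge_riders_match eta Y'); apply: emax.
  by rewrite (greedy_edgesE run) inE Y'E.
have [etae|etaNe] := boolP (inl eta \in e).
  by left; exists e; rewrite !inE eqxx; split=> //; apply: leq_trans lY le.
right; rewrite cover_setU1 -setI_eq0 setIUr setU_eq0 !setI_eq0; apply/andP; split.
  (* The edge [e] has at least two riders, so they all stop being unshared and none of them remains
     in [Y]. *)
  rewrite disjoint_match_edge etaNe /= -setI_eq0; apply/eqP/setP => r.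
  rewrite !inE; apply/negP => /andP[/andP[_ /negP rN] re]; apply: rN.
  apply/bigcupP; exists e => //.
  by rewrite !inE eqxx (leq_trans Y'2 le).
move: dis; rewrite !disjoint_match_edge => /andP[-> dis] /=.
exact: disjointWl dis.
Qed.

(** At the end of the run every rider is covered, so the nonempty set of unshared riders of [S]
    cannot be untouched. *)
Lemma greedy_output_large M (eta : D) S : greedy_output I M ->
  match_edge eta S \in E -> 1 < #|S :&: unshared_riders M| ->
  exists e, [/\ e \in M, inl eta \in e
              & #|S :&: unshared_riders M| <= #|edge_riders e|].
Proof.
move=> [[H run] cov] SE Y2; case: (greedy_run_large run SE Y2) => //.
have /card_gt0P[r rY] := ltnW Y2.
rewrite disjoint_match_edge => /andP[_ dis].
by have := disjointFr dis rY; rewrite inE cov.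
Qed.

(** Charging argument: each [f] with positive excess is charged to a greedy edge using the same
    driver. *)
Lemma greedy_sum_excess M N : greedy_output I M -> N \subset E -> trivIset N ->
  \sum_(f in N) (#|edge_riders f :&: unshared_riders M| - 2)
  <= \sum_(e in M) (#|edge_riders e| - 2).
Proof.
move=> out sN triv; have [[H run] _] := out.
have [sM _] := greedy_run_triv run.
pose share f e := [exists d : D, (inl d \in f) && (inl d \in e)].
apply: (@leq_trans
  (\sum_(f in N) \sum_(e in M | share f e) (#|edge_riders e| - 2))).
  apply: leq_sum => f fN.
  (* With at most one unshared rider the truncated excess is 0, and there is nothing to charge. *)
  have [|Y2] := leqP #|edge_riders f :&: unshared_riders M| 1.
    by move=> ?; rewrite (_ : _ - 2 = 0) //; lia.
  have fE := subsetP sN _ fN; have [eta [S [fS _ _]]] := instance_edges fE.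
  rewrite fS edge_riders_match in Y2 fE *.
  have [e [eM etae le]] := greedy_output_large out fE Y2.
  rewrite (bigD1 e) /=; first by apply: leq_trans (leq_addr _ _); lia.
  by rewrite eM; apply/existsP; exists eta; rewrite inl_match_edge eqxx.
(* Seen from the greedy side, [e] has a single driver, and disjointness of [N] leaves at most one
   [f] containing it. *)
rewrite (exchange_big_dep (mem M)) /=; last by move=> f e _ /andP[].
apply: leq_sum => e eM.
have [eta [S [eS _ _]]] := instance_edges (subsetP sM _ eM).
rewrite sum_nat_cond_const -[leqRHS]mul1n leq_mul2r; apply/orP; right.
apply/card_le1_eqP => f g; rewrite !inE.
have shareP h : share h e -> inl eta \in h.
  by case/existsP => d; rewrite eS inl_match_edge => /andP[hd /eqP <-].
move=> /and3P[fN _ /shareP etaf] /and3P[gN _ /shareP etag].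
apply/eqP; apply/negPn/negP => neq.
have dis := trivIsetP triv _ _ gN fN neq.
by move: (disjointFr dis etag); rewrite etaf.
Qed.

Lemma greedy_bound M N : greedy_output I M -> feasible_solution I N ->
  2 * #|M| <= (max_capacity I + 2) * #|N|.
Proof.
move=> out [sN trivN covN]; have [[H run] covM] := out.
have [sM trivM] := greedy_run_triv run.
have exc := greedy_sum_excess out sN trivN.
have unsh := sum_card_edge_riders (unshared_riders M) trivN.
have covNT : edge_riders (cover N) = setT.
  by apply/setP => r; rewrite !inE covN.
rewrite covNT setTI card_unshared_riders // in unsh.
have sumN : \sum_(f in N) #|edge_riders f :&: unshared_riders M|
    <= \sum_(f in N) (#|edge_riders f :&: unshared_riders M| - 2) + 2 * #|N|.
  by rewrite mulnC -sum_nat_const -big_split leq_sum // => f _ /=; lia.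
have sumM : 2 * #|M| + \sum_(e in M) (#|edge_riders e| - 2)
    = #|R| + \sum_(e in M | #|edge_riders e| <= 1) #|edge_riders e|.
  rewrite -(sum_card_covering trivM covM) [in RHS]big_mkcondr /=.
  rewrite mulnC -sum_nat_const -!big_split; apply: eq_bigr => e eM /=.
  (* The identity holds edge by edge, but only for nonempty rider sets: with 0 riders the left side
     would be 2 and the right side 0. *)
  by have := edge_gt0 (subsetP sM _ eM); case: ifP; lia.
have cardR : #|R| <= max_capacity I * #|N|.
  rewrite -(sum_card_covering trivN covN) mulnC -sum_nat_const.
  by apply: leq_sum => f fN; apply: edge_le_max; apply: (subsetP sN).
rewrite mulnDl; lia.
Qed.

End Greedy.

Theorem theorem4 (D R : finType) (I : mtrs_instance D R)
    (hcard : #|D| = #|R|)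
    (hcomplete : forall (eta : D) (r : R),
       match_edge eta [set r] \in hedges (instance_hypergraph I))
    (hlambda : (2 <= max_capacity I)%N)
    (M Mopt : {set {set D + R}})
    (hM : greedy_output I M) (hopt : optimal_solution I Mopt) :
  #|M|%:R / #|Mopt|%:R <= ((max_capacity I)%:R + 2) / 2 :> rat.
Proof.
have [feas _] := hopt; have bound := greedy_bound hM feas.
(* If [Mopt] is empty, the quotient is 0 by the convention for division by zero. *)
have [->|N0] := posnP #|Mopt|.
  by rewrite invr0 mulr0 divr_ge0 ?addr_ge0 ?ler0n.
rewrite ler_pdivrMr ?ltr0n // mulrAC ler_pdivlMr ?ltr0n //.
by rewrite -!natrD -!natrM ler_nat mulnC.
Qed.
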